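(* Let $p\ge 1$, $\mathbb{P}\in\mathcal{P}_p(\mathbb{R}^d)$, $x_0\in\mathbb{R}\setminus\{0\}$, and let $D\subseteq\mathbb{R}^d$ be non-empty and closed. Let $U:\mathbb{R}\to\mathbb{R}$ be a non-decreasing, non-constant, differentiable and concave function, and assume that there exist constants $C_1,\underline{x}>0$ such that $U(-\underline{x})<0$ and $$U(x)\ge -C_1(1+|x|^p)\qquad\text{for all } x\le -\underline{x}.$$ Furthermore assume that one of the following three conditions holds true: (i) $U$ is bounded from above; (ii) $\mathrm{AE}_{-\infty}(U):=\liminf_{x\to-\infty}\frac{xU'(x)}{U(x)}>1$; (iii) $\mathrm{AE}_{+\infty}(U):=\limsup_{x\to+\infty}\frac{xU'(x)}{U(x)}<1$. Then $w_k:=\arg\max_{w\in D}u(k,w)$ is well-defined, and $\lim_{k\to\infty}w_k$ exists and belongs to $$\mathcal{D}:=\Big\{\overline{w}\in D:\ |\overline{w}|=\inf_{w\in D}|w|\Big\}.$$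
   Context: $|\cdot|$ and $\langle\cdot,\cdot\rangle$ are the Euclidean norm and scalar product on $\mathbb{R}^d$. $X:\mathbb{R}^d\to\mathbb{R}^d$ is the identity map. $\mathcal{P}_p(\mathbb{R}^d)$ is the set of Borel probability measures $\mathbb{Q}$ on $\mathbb{R}^d$ with $\mathbb{E}_{\mathbb{Q}}[|X|^p]<\infty$. $\mathcal{W}_p$ is the $p$-Wasserstein metric for the Euclidean norm, $\mathcal{W}_p(\mathbb{P},\mathbb{Q})=(\inf_{\pi}\int|x-y|^p\,d\pi)^{1/p}$ over couplings $\pi$ of $\mathbb{P},\mathbb{Q}$, and for $k>0$, $B_k(\mathbb{P})=\{\mathbb{Q}\in\mathcal{P}_p(\mathbb{R}^d):\mathcal{W}_p(\mathbb{P},\mathbb{Q})\le k\}$. For $k>0$ and $w\in\mathbb{R}^d$, $$u(k,w):=\inf_{\mathbb{Q}\in B_k(\mathbb{P})}\mathbb{E}_{\mathbb{Q}}[U(x_0+x_0\langle w,X\rangle)].$$ $w_k$ denotes a maximizer of $u(k,\cdot)$ over $D$; ''well-defined'' means that such a maximizer exists.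
   Formalization: Instead of ''lim w_k exists and belongs to 𝒟'', which fails when 𝒟 has several points (e.g. D={-1,1}, P=δ_0), every selection of maximizers is shown to have, along any k_n→∞, a subsequence converging to a point of 𝒟, and to converge to it when 𝒟 is a single point. *)

(* Defs.v *)
From mathcomp Require Export all_boot all_order all_algebra.
From mathcomp Require Export all_classical all_reals all_analysis.
Export Order.TTheory GRing.Theory Num.Theory.
Export numFieldNormedType.Exports.

Set Implicit Arguments.
Unset Strict Implicit.
Unset Printing Implicit Defensive.

Global Open Scope classical_set_scope.
Global Open Scope ring_scope.

Definition dot (R : realType) (d : nat) (x y : 'rV[R]_d) : R :=
  \sum_(i < d) x 0 i * y 0 i.

(* The canonical norm of 'rV[R]_d is the sup norm, hence a separate Euclidean
   norm; both induce the same topology, so the library's [closed], [open] and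
   convergence on 'rV[R]_d are the Euclidean ones. *)
Definition enorm (R : realType) (d : nat) (x : 'rV[R]_d) : R :=
  Num.sqrt (dot x x).

Definition borel_rV (R : realType) (d : nat) :=
  g_sigma_algebraType (@open 'rV[R]_d).

Section Wasserstein.
Context (R : realType) (d : nat).
Local Notation prob := (probability (borel_rV R d) R).
Implicit Types P Q : prob.

Definition Pp (p : R) : set prob :=
  [set Q | ('E_Q[fun x : borel_rV R d => (enorm x `^ p)%R] < +oo)%E].

Definition couplings P Q :
    set (probability (borel_rV R d * borel_rV R d)%type R) :=
  [set pi | (forall A : set (borel_rV R d), measurable A ->
              pi (A `*` [set: borel_rV R d]) = P A) /\
            (forall A : set (borel_rV R d), measurable A ->
              pi ([set: borel_rV R d] `*` A) = Q A)].

Definition transport_cost (p : R)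
    (pi : probability (borel_rV R d * borel_rV R d)%type R) : \bar R :=
  (\int[pi]_z ((enorm ((z.1 : 'rV[R]_d) - (z.2 : 'rV[R]_d))) `^ p)%:E)%E.

Definition Wp (p : R) P Q : \bar R :=
  poweR (ereal_inf [set transport_cost p pi | pi in couplings P Q]) p^-1.

Definition Wball (p : R) P (k : R) : set prob :=
  [set Q | Pp p Q /\ (Wp p P Q <= k%:E)%E].

Definition robust_utility (p : R) P (x0 : R) (U : R -> R)
    (k : R) (w : 'rV[R]_d) : \bar R :=
  ereal_inf [set ('E_Q[fun x : borel_rV R d => (U (x0 + x0 * dot w x))%R])%E
            | Q in Wball p P k].

End Wasserstein.

Definition argmax (R : realType) (T : Type) (D : set T) (f : T -> \bar R) :
    set T :=
  [set w | D w /\ forall v, D v -> (f v <= f w)%E].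

Definition min_norm (R : realType) (d : nat) (D : set 'rV[R]_d) :
    set 'rV[R]_d :=
  [set w | D w /\ enorm w = inf [set enorm v | v in D]].

Definition concave (R : realType) (U : R -> R) : Prop :=
  @convex_function R R^o setT (fun x => - U x).

Definition elasticity (R : realType) (U : R -> R) (x : R) : \bar R :=
  (x * derive1 U x / U x)%:E.

(* Division by zero is harmless in these two limits: U < 0 near -oo as soon as
   U is negative somewhere and non-decreasing; near +oo, U is eventually
   positive unless U <= 0, in which case U is bounded from above. *)
Definition AE_ninfty (R : realType) (U : R -> R) : \bar R :=
  limf_einf (elasticity U) (ninfty_nbhs R).

Definition AE_pinfty (R : realType) (U : R -> R) : \bar R :=
  limf_esup (elasticity U) (pinfty_nbhs R).

(* Main.v *)
(* A concave, non-decreasing, non-constant U satisfies (i), (ii) or (iii) only if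
   the ratio of its slope at +oo to its slope at -oo is zero. Moving a small
   mass of P to the unit vector that is worst for w then makes the expected
   utility decrease at least linearly in |w|, and since u(k, .) is upper
   semicontinuous, a maximizer exists.

   For the limit, let v have minimal norm in D and let |w| >= |v| + delta. If Q is
   in B_k(P), the law under Q of (1 + eta) |<v, X>| / |w| times the worst unit
   vector for w has p-th moment norm at most (1 + eta) |v| / |w| (|X|_P + k), so
   for k large it is again in B_k(P). By concavity this gives
     u(k, w) <= (1 + eta) u(k, v) - eta U(x0),
   hence u(k, w) < u(k, v), because u(k, v) < U(x0) for k large when v <> 0. When
   v = 0, a point mass far from the origin suffices. *)
Require Import Defs.
From HB Require Import structures.
From mathcomp Require Import ring lra measurable_realfun hoelder.

Set Implicit Arguments.
Unset Strict Implicit.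
Unset Printing Implicit Defensive.

(** * Concave functions on the line *)

Section concave_real.
Context (R : realType) (U : R -> R).
Hypothesis U_ndecr : {homo U : x y / x <= y}.
Hypothesis U_nconst : exists x y, U x <> U y.
Hypothesis U_deriv : forall x, derivable U x 1.
Hypothesis U_conc : concave U.

(** By concavity, the difference quotient of [U] from [a] towards [y] with step [t] in (0, 1] is at
    least [U y - U a]. Its limit as [t] tends to 0 is the directional derivative. *)
Lemma concave_tangent a y : U y <= U a + derive1 U a * (y - a).
Proof.
have Ua : differentiable U a by apply/derivable1_diffP.
have key (t : R) : 0 < t -> t <= 1 ->
    U y - U a <= t^-1 *: (U (t *: (y - a) + a) - U a).
  move=> t0 t1.
  have h : - U (t * y + (1 - t) * a) <= t * - U y + (1 - t) * - U a.
    exact: (@U_conc (Itv01 (ltW t0) t1) y a (mem_set I) (mem_set I)).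
  have e : t *: (y - a) + a = t * y + (1 - t) * a by rewrite /GRing.scale /=; ring.
  rewrite e.
  rewrite /GRing.scale /= -ler_pdivrMl ?invr_gt0// invrK.
  lra.
have dU : 'D_(y - a) U a = derive1 U a * (y - a).
  by rewrite deriveE// deriv1E// /GRing.scale /= mulrC.
have /cvg_ex[l hl] : derivable U a (y - a) by exact: diff_derivable.
suff : U y - U a <= l.
  have <- : 'D_(y - a) U a = l by exact: cvg_lim hl.
  by rewrite dU; lra.
(* Concavity controls only positive steps, so the two-sided limit is restricted to the right of
   0. *)
have hl' : (fun h : R => h^-1 *: (U (h *: (y - a) + a) - U a)) @ 0^'+ --> l.
  apply: cvg_trans hl; apply: cvg_app; apply: within_subset => //.
  by move=> t; rewrite /= => /gt_eqF/negbT.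
apply: (cvgr_to_ge hl').

near=> t; apply: key => //.
by near: t; apply: nbhs_right_le.
Unshelve. all: by end_near. Qed.

Let G := derive1 U.

Lemma concave_deriv_ge0 a : 0 <= G a.
Proof.
have := concave_tangent a (a + 1).
have : U a <= U (a + 1) by apply: U_ndecr; rewrite lerDl.
by rewrite -/G; lra.
Qed.

(** With zero slope at [x], the tangent there would forbid any larger value of [U]. *)
Lemma concave_deriv_pos : exists a, 0 < G a.
Proof.
have [x [y xy]] := U_nconst.
wlog xly : x y xy / x <= y.
  move=> h; have [|/ltW] := leP x y; first exact: h.
  by apply: h => e; apply: xy.
exists x; have := concave_tangent x y; rewrite -/G.
have : U x < U y by rewrite lt_neqAle U_ndecr // andbT; apply/eqP.
move: (concave_deriv_ge0 x); rewrite -/G le_eqVlt => /predU1P[<-|//].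
lra.
Qed.

(** A tangent of positive slope lies above [U] and tends to -oo on the left. *)
Lemma concave_ray_decay M : exists2 t0, 0 <= t0 & forall t, t0 <= t -> U (- t) < M.
Proof.
have [a Ga] := concave_deriv_pos.
exists (Num.max 0 ((`|U a| + `|M| + 1) / G a + `|a|)).
  by rewrite le_max lexx.
move=> t; rewrite ge_max => /andP[t0 ht].
have := concave_tangent a (- t); rewrite -/G => h.
have h2 : (`|U a| + `|M| + 1) / G a <= t + a.
  by have := ler_norm (- a); rewrite normrN; lra.
have : `|U a| + `|M| + 1 <= G a * (t + a) by rewrite mulrC -ler_pdivrMr.
have := ler_norm (U a); have := ler_norm (- M); rewrite normrN; nra.
Qed.

(** Both increments are compared with [s * G y]: the step to the right gains at most [h] times it,
    the step to the left loses at least it. *)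
Lemma concave_extrapolation y s h : 0 <= s -> 0 <= h ->
  U (y + h * s) <= U y + h * (U y - U (y - s)).
Proof.
move=> s0 h0; have := concave_tangent y (y + h * s).
by have := concave_tangent y (y - s); rewrite -/G; nra.
Qed.

(** The point [y - t] is the convex combination of [y - (1 + e) * t] and [y] with weights
    proportional to 1 and [e]. *)
Lemma concave_star y t e : 0 <= e ->
  U (y - (1 + e) * t) <= (1 + e) * U (y - t) - e * U y.
Proof.
move=> e0; have := concave_tangent (y - t) (y - (1 + e) * t).
by have := concave_tangent (y - t) y; rewrite -/G; nra.
Qed.

Lemma AE_pinfty_lt1 : (AE_pinfty U < 1)%E -> exists g M, g < 1 /\
  forall x, M < x -> x * G x / U x <= g.
Proof.
rewrite /AE_pinfty /limf_esup => /ereal_inf_lt[_ [V VF <-]].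
case: VF => M [_ MV] h.
have VM : V (M + 1) by apply: MV; rewrite /= ltrDl.
have sup_ge x : M < x -> (elasticity U x <= ereal_sup (elasticity U @` V))%E.
  by move=> Mx; apply: ereal_sup_ubound; exists x => //; exact: MV.
move: h sup_ge; case: (ereal_sup _) => [g|//|].
- rewrite lte_fin => g1 sup_ge; exists g, M; split; [by []|exact: sup_ge].
(* The supremum cannot be -oo, since [V] contains [M + 1], where the elasticity is finite. *)
- by move=> _ /(_ (M + 1)); rewrite ltrDl ltr01 => /(_ isT).
Qed.

Lemma AE_ninfty_gt1 : (1 < AE_ninfty U)%E -> exists g M, 1 < g /\
  forall x, x < M -> g <= x * G x / U x.
Proof.
rewrite /AE_ninfty limf_einfE => /ereal_sup_gt[_ [V VF <-]].
case: VF => M [_ MV] h.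
have VM : V (M - 1) by apply: MV; rewrite /= ltrBlDr ltrDl.
have inf_le x : x < M -> (ereal_inf (elasticity U @` V) <= elasticity U x)%E.
  by move=> Mx; apply: ereal_inf_lbound; exists x => //; exact: MV.
move: h inf_le; case: (ereal_inf _) => [g|_|//].
- rewrite lte_fin => g1 inf_le; exists g, M; split; [by []|exact: inf_le].
- by move=> /(_ (M - 1)); rewrite ltrBlDr ltrDl ltr01 => /(_ isT).
Qed.

(* That is, the ratio of the slope of [U] at +oo to its slope at -oo is zero. *)
Lemma slope_ratio (xl : R) : U (- xl) < 0 ->
  has_ubound (range U) \/ (1 < AE_ninfty U)%E \/ (AE_pinfty U < 1)%E ->
  forall e, 0 < e -> exists a b, 0 < G a /\ G b <= e * G a.
Proof.
move=> Uxl Ucond e e0; apply: contrapT => H.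
have {}H a b : 0 < G a -> e * G a < G b.
  move=> Ga; rewrite ltNge; apply/negP => Gb; apply: H.
  by exists a, b.
have [a0 Ga0] := concave_deriv_pos.
(* If the claim fails, comparing every point with [a0] in either role confines all slopes between
   [c > 0] and [L]. *)
pose c := e * G a0; have c0 : 0 < c by exact: mulr_gt0.
have cG x : c < G x by exact: H.
pose L := G a0 / e.
have GL x : G x <= L.
  by rewrite /L ler_pdivlMr// mulrC ltW// H// (lt_trans c0).
have grow x : U 0 + c * x <= U x \/ x < 0.
  have [x0|] := leP 0 x; [left|by right].
  have := concave_tangent x 0; rewrite -/G; have := cG x; nra.
have Gsup : has_sup (range G) by split; [exists (G 0), 0|exists L => _ [x _ <-]].
have Ginf : has_inf (range G).
  by split; [exists (G 0), 0|exists 0 => _ [x _ <-]; exact: concave_deriv_ge0].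
case: Ucond => [[M MU]|[/AE_ninfty_gt1|/AE_pinfty_lt1] [g [M [g1 gM]]]].
(* Case (i): with slopes above [c], [U] exceeds any bound. *)
- have [] := grow ((`|M| + `|U 0| + 1) / c).
    rewrite mulrCA divff ?gt_eqF// mulr1.
    have := MU (U ((`|M| + `|U 0| + 1) / c)) (ex_intro2 _ _ _ I erefl).
    by have := ler_norm M; have := ler_norm (- U 0); rewrite normrN; lra.
  by apply/negP; rewrite -leNgt divr_ge0 ?ltW// addr_ge0// ltW.
(* Case (ii): let S be the supremum of the slopes and choose [z] with [g * G z > S]. For [x] far to
   the left, the elasticity bound and the tangent at [z] give [x * S <= x * G x <= g * U x <= K + g
   * G z * x], which fails as [x] tends to -oo. *)
- have S0 : 0 < sup (range G).
    by apply: lt_le_trans Ga0 _; apply: ub_le_sup; [exact: Gsup.2|exists a0].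
  have [_ [z _ <-] hz] : exists2 y, range G y & sup (range G) / g < y.
    apply: sup_gt; first by exists (G 0), 0.
    by rewrite ltr_pdivrMr ?ltr_pMr// (lt_trans ltr01).
  have {}hz : 0 < g * G z - sup (range G).
    by move: hz; rewrite ltr_pdivrMr ?(lt_trans _ g1)// subr_gt0 mulrC.
  pose K := g * (U z - G z * z).
  pose x := Num.min (M - 1) (Num.min (- `|xl| - 1) (- ((`|K| + 1) / (g * G z - sup (range G))))).
  have /andP[xM /andP[xxl xK]] : [&& x <= M - 1, x <= - `|xl| - 1
      & x <= - ((`|K| + 1) / (g * G z - sup (range G)))].
    by rewrite !ge_min !lexx ?orbT.
  have x0 : x < 0 by have := normr_ge0 xl; lra.
  have Ux0 : U x < 0.
    by apply: le_lt_trans Uxl; apply: U_ndecr; have := ler_norm xl; lra.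
  have : g <= x * G x / U x by apply: gM; lra.
  rewrite ler_ndivlMr// => h1.
  have h2 := concave_tangent z x; rewrite -/G in h2.
  have h3 : G x <= sup (range G) by apply: ub_le_sup; [exact: Gsup.2|exists x].
  have h4 : `|K| + 1 <= - x * (g * G z - sup (range G)).
    by rewrite -ler_pdivrMr//; lra.
  have h5 : x * sup (range G) <= x * G x by rewrite ler_nM2l.
  have h6 : g * U x <= g * (U z + G z * (x - z)) by rewrite ler_pM2l; lra.
  by move: (ler_norm K) h4 h5 h6 h1; rewrite /K; lra.
(* Case (iii), the mirror image: with I the infimum of the slopes and [g * G z < I], one gets [x * I
   <= x * G x <= g * U x <= K + g * G z * x], which fails as [x] tends to +oo. *)
- have I0 : 0 < inf (range G).
    apply: lt_le_trans c0 _; apply: lb_le_inf; first by exists (G 0), 0.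
    by move=> _ [x _ <-]; exact: ltW.
  have [z hz] : exists z, 0 < inf (range G) - g * G z.
    have [g0|g0] := leP g 0.
      by exists 0; have := cG 0; nra.
    have [_ [z _ <-] hz] : exists2 y, range G y & y < inf (range G) / g.
      apply: inf_lt; first by exists (G 0), 0.
      by rewrite ltr_pdivlMr// gtr_pMr.
    by exists z; move: hz; rewrite ltr_pdivlMr//; lra.
  pose K := g * (U z - G z * z).
  pose x := Num.max (M + 1) (Num.max ((`|U 0| + 1) / c)
    ((`|K| + 1) / (inf (range G) - g * G z))).
  have /and3P[xM xU xK] : [&& M + 1 <= x, (`|U 0| + 1) / c <= x
      & (`|K| + 1) / (inf (range G) - g * G z) <= x].
    by rewrite !le_max !lexx ?orbT.
  have x0 : 0 < x by apply: lt_le_trans xU; rewrite divr_gt0// ltr_pwDr.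
  have Ux0 : 0 < U x.
    have [|] := grow x; last by rewrite ltNge ltW.
    move: xU; rewrite ler_pdivrMr//.
    by have := ler_norm (- U 0); rewrite normrN; lra.
  have : x * G x / U x <= g by apply: gM; lra.
  rewrite ler_pdivrMr// => h1.
  have gp : 0 < g.
    by have : 0 < x * G x by [rewrite mulr_gt0// (lt_trans c0)]; nra.
  have h2 := concave_tangent z x; rewrite -/G in h2.
  have h3 : inf (range G) <= G x by apply: ge_inf; [exact: Ginf.2|exists x].
  have h4 : `|K| + 1 <= x * (inf (range G) - g * G z) by rewrite -ler_pdivrMr.
  have h5 : x * inf (range G) <= x * G x by rewrite ler_pM2l.
  have h6 : g * U x <= g * (U z + G z * (x - z)) by rewrite ler_pM2l.
  by move: (ler_norm K) h4 h5 h6 h1; rewrite /K; lra.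
Qed.
End concave_real.

(** * Euclidean norm and Borel structure *)

Section euclidean.
Context (R : realType) (d : nat).
Implicit Types (x y z : 'rV[R]_d) (a : R).

Lemma dotC x y : dot x y = dot y x.
Proof. by apply: eq_bigr => i _; rewrite mulrC. Qed.

Lemma dotDr x y z : dot x (y + z) = dot x y + dot x z.
Proof. by rewrite -big_split; apply: eq_bigr => i _; rewrite !mxE mulrDr. Qed.

Lemma dotZr x a y : dot x (a *: y) = a * dot x y.
Proof. by rewrite mulr_sumr; apply: eq_bigr => i _; rewrite !mxE mulrCA. Qed.

Lemma dot0r x : dot x 0 = 0.
Proof. by rewrite -(scale0r 0) dotZr mul0r. Qed.

Lemma dotDl x y z : dot (x + y) z = dot x z + dot y z.
Proof. by rewrite dotC dotDr !(dotC z). Qed.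

Lemma dotZl a x y : dot (a *: x) y = a * dot x y.
Proof. by rewrite dotC dotZr dotC. Qed.

Lemma dotNr x y : dot x (- y) = - dot x y.
Proof. by rewrite -scaleN1r dotZr mulN1r. Qed.

Lemma dotNl x y : dot (- x) y = - dot x y.
Proof. by rewrite dotC dotNr dotC. Qed.

Lemma dot_ge0 x : 0 <= dot x x.
Proof. by apply: sumr_ge0 => i _; rewrite -expr2 sqr_ge0. Qed.

Lemma dot_eq0 x : dot x x = 0 -> x = 0.
Proof.
move=> /eqP; rewrite psumr_eq0 => [/allP x0|i _]; last by rewrite -expr2 sqr_ge0.
apply/rowP => i; rewrite mxE; apply/eqP.
by have := x0 i (mem_index_enum _); rewrite mulf_eq0 orbb.
Qed.

Lemma enorm_ge0 x : 0 <= enorm x. Proof. exact: sqrtr_ge0. Qed.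

Lemma enorm0 : enorm (0 : 'rV[R]_d) = 0.
Proof. by rewrite /enorm dot0r sqrtr0. Qed.

Lemma sqr_enorm x : enorm x ^+ 2 = dot x x.
Proof. by rewrite sqr_sqrtr// dot_ge0. Qed.

Lemma enorm_eq0 x : enorm x = 0 -> x = 0.
Proof. by move=> x0; apply: dot_eq0; rewrite -sqr_enorm x0 expr0n. Qed.

Lemma enormZ a x : enorm (a *: x) = `|a| * enorm x.
Proof.
rewrite /enorm dotZl dotZr mulrA -expr2 sqrtrM ?sqr_ge0//.
by rewrite sqrtr_sqr.
Qed.

Lemma enormN x : enorm (- x) = enorm x.
Proof. by rewrite /enorm dotNl dotNr opprK. Qed.

(** Cauchy-Schwarz: expand the squared norm of [dot y y *: x - dot x y *: y] and divide by
    [dot y y]; the case [y = 0] is separate. *)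
Lemma dot_le x y : `|dot x y| <= enorm x * enorm y.
Proof.
rewrite -sqrtrM ?dot_ge0// -sqrtr_sqr ler_sqrt ?mulr_ge0 ?dot_ge0//.
have := dot_ge0 (dot y y *: x - dot x y *: y).
rewrite dotDl !dotDr !dotNl !dotNr !dotZl !dotZr (dotC y x).
have := dot_ge0 y; rewrite le_eqVlt => /predU1P[/esym/dot_eq0 ->|y0 h].
  by move=> _; rewrite !dot0r mulr0 expr0n.
by rewrite -subr_ge0 -(pmulr_rge0 _ y0); lra.
Qed.

Lemma enormD x y : enorm (x + y) <= enorm x + enorm y.
Proof.
rewrite -(@ler_pXn2r _ 2)// ?nnegrE ?addr_ge0 ?enorm_ge0//.
rewrite sqrrD !sqr_enorm dotDl !dotDr (dotC y x).
by have := dot_le x y; have := ler_norm (dot x y); lra.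
Qed.

Lemma normr_le_enorm x : `|x| <= enorm x.
Proof.
rewrite -[`|x|]/(mx_norm x) mx_normrE; apply: bigmax_le => [|[i j] _]; first exact: enorm_ge0.
rewrite /= ord1 -sqrtr_sqr ler_sqrt ?dot_ge0// /dot (bigD1 j)//= -expr2.
by rewrite lerDl sumr_ge0// => k _; rewrite -expr2 sqr_ge0.
Qed.

Lemma continuous_dot x : continuous (dot x).
Proof.
move=> y; apply: (cvg_big (@add_continuous R^o) (nbhs_filter y)) => i _.
by apply: cvgM; [exact: cvg_cst|exact: coord_continuous].
Qed.

Lemma continuous_enorm : continuous (@enorm R d).
Proof.
move=> x; apply: continuous_comp; last exact: sqrt_continuous.
apply: (cvg_big (@add_continuous R^o) (nbhs_filter x)) => i _.
by apply: cvgM; exact: coord_continuous.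
Qed.

End euclidean.

Section borel.
Context (R : realType) (d : nat).
Local Notation rV := 'rV[R]_d.
Local Notation brV := (borel_rV R d).

Lemma continuous_borel_measurable (f : rV -> R) :
  continuous f -> measurable_fun [set: brV] (f : brV -> R).
Proof.
move=> /continuousP cf; apply: (measurability _ (RGenOpens.measurableE R)).
move=> _ [_ [a [b ->] <-]]; rewrite setTI; apply: sub_sigma_algebra.
exact/cf/interval_open.
Qed.

Lemma continuous_borel_measurable_rV (f : rV -> rV) :
  continuous f -> measurable_fun [set: brV] (f : brV -> brV).
Proof.
move=> /continuousP cf; apply: (@measurability _ _ brV brV setT f (@open rV)) => //.
by move=> _ [A oA <-]; rewrite setTI; apply: sub_sigma_algebra; exact: cf.
Qed.

Lemma measurable_dot (w : rV) : measurable_fun [set: brV] (dot w : brV -> R).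
Proof. by apply: continuous_borel_measurable; exact: continuous_dot. Qed.

Lemma measurable_enorm : measurable_fun [set: brV] (@enorm R d : brV -> R).
Proof. by apply: continuous_borel_measurable; exact: continuous_enorm. Qed.

Lemma measurable_sqrtr : measurable_fun [set: R] (@Num.sqrt R).
Proof. by apply: continuous_measurable_fun => x; exact: sqrt_continuous. Qed.

(** The product carries the sigma-algebra generated by the two projections, not one defined from its
    open sets, so the proof goes through coordinates instead of continuity. *)
Lemma measurable_dist :
  measurable_fun [set: brV * brV] (fun z => enorm (z.1 - z.2 : rV)).
Proof.
have m1 i : measurable_fun [set: brV * brV] (fun z => (z.1 : rV) 0 i - (z.2 : rV) 0 i).
  have mi : measurable_fun [set: brV] (fun x => (x : rV) 0 i).
    by apply: continuous_borel_measurable => x; exact: coord_continuous.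
  by apply: measurable_funB; [apply: (measurableT_comp mi)|apply: (measurableT_comp mi)].
rewrite (_ : (fun z => _) = fun z : brV * brV => Num.sqrt
    (\sum_(i < d) ((z.1 : rV) 0 i - (z.2 : rV) 0 i) * ((z.1 : rV) 0 i - (z.2 : rV) 0 i))).
  apply: (measurableT_comp measurable_sqrtr); apply: measurable_sum => i.
  exact: measurable_funM.
by apply/funext => z; congr Num.sqrt; apply: eq_bigr => i _; rewrite !mxE.
Qed.

End borel.

(** * Image measures and mixtures *)

Lemma LnormE d (T : measurableType d) (R : realType)
    (mu : {measure set T -> \bar R}) (p : R) (f : T -> R) : (forall x, 0 <= f x) ->
  Lnorm mu p%:E (EFin \o f) = ((\int[mu]_x (f x `^ p)%:E) `^ p^-1)%E.
Proof.
move=> f0; rewrite unlock /=; congr (_ `^ _)%E.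
by apply: eq_integral => x _; rewrite /= ger0_norm// poweR_EFin.
Qed.

Section law.
Context d1 d2 (S : measurableType d1) (T : measurableType d2) (R : realType).

Definition law (P : probability S R) (f : S -> T)
    (mf : measurable_fun setT f) : probability T R :=
  distribution P (mfun_Sub (mem_set mf)).

Context (P : probability S R) (f : S -> T) (mf : measurable_fun setT f).

Lemma integral_law_ge0 (g : T -> R) : measurable_fun setT g ->
  (forall y, 0 <= g y) ->
  (\int[law P mf]_y (g y)%:E = \int[P]_x (g (f x))%:E)%E.
Proof.
move=> mg g0; rewrite ge0_integral_pushforward//.
- exact: measurableT_comp.
- by move=> y _; rewrite lee_fin.
Qed.

Lemma integral_law (g : T -> R) : measurable_fun setT g ->
  P.-integrable setT (fun x => (g (f x))%:E) ->
  (\int[law P mf]_y (g y)%:E = \int[P]_x (g (f x))%:E)%E.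
Proof.
move=> mg ig; rewrite integral_pushforward//.
exact: measurableT_comp.
Qed.

Lemma Lnorm_law (p : R) (g : T -> R) : measurable_fun setT g ->
  (forall y, 0 <= g y) ->
  Lnorm (law P mf) p%:E (EFin \o g) = Lnorm P p%:E (EFin \o (g \o f)).
Proof.
move=> mg g0; rewrite !LnormE//; last by move=> x; exact: g0.
rewrite (integral_law_ge0 (g := fun y => g y `^ p))//.
  exact: (measurableT_comp (measurable_powR _)).
by move=> y; rewrite powR_ge0.
Qed.

End law.

Section mixture.
Context d (T : measurableType d) (R : realType) (P Q : probability T R).
Context (e : R) (e0 : 0 <= e) (e1 : 0 <= 1 - e).

Definition mixture : set T -> \bar R :=
  measure_add (mscale (NngNum e0) P) (mscale (NngNum e1) Q).

HB.instance Definition _ := Measure.on mixture.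

Lemma mixtureE A : mixture A = (e%:E * P A + (1 - e)%:E * Q A)%E.
Proof. by rewrite /mixture /measure_add /msum !big_ord_recl big_ord0 adde0. Qed.

Let mixture_setT : mixture setT = 1%E.
Proof.
by rewrite mixtureE !probability_setT !mule1 -EFinD addrC subrK.
Qed.

HB.instance Definition _ := Measure_isProbability.Build _ _ _ mixture mixture_setT.

Lemma ge0_integral_mixture (g : T -> \bar R) : measurable_fun setT g ->
  (forall y, 0 <= g y)%E ->
  (\int[mixture]_y g y = e%:E * \int[P]_y g y + (1 - e)%:E * \int[Q]_y g y)%E.
Proof.
move=> mg g0; rewrite ge0_integral_measure_add//.
by rewrite !ge0_integral_mscale.
Qed.

Lemma integral_mixture (g : T -> \bar R) :
  P.-integrable setT g -> Q.-integrable setT g ->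
  (\int[mixture]_y g y = e%:E * \int[P]_y g y + (1 - e)%:E * \int[Q]_y g y)%E.
Proof.
move=> iP iQ; have mg := measurable_int _ iP.
rewrite integralE [in RHS]integralE [X in (_ + _ * X)%E]integralE.
rewrite !ge0_integral_mixture//; first last.
- exact: measurable_funepos.
- exact: measurable_funeneg.
(* Positive and negative parts have finite integrals under both measures, so the four terms can be
   regrouped as real numbers. *)
have aux (a b c d' : \bar R) : a \is a fin_num -> b \is a fin_num ->
    c \is a fin_num -> d' \is a fin_num ->
    (e%:E * a + (1 - e)%:E * b - (e%:E * c + (1 - e)%:E * d') =
     e%:E * (a - c) + (1 - e)%:E * (b - d'))%E.
  case: a b c d' => [a||] [b||] [c||] [d'||]// _ _ _ _.
  by congr EFin; ring.
by apply: aux; do ?[exact: integrable_pos_fin_num|exact: integrable_neg_fin_num].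
Qed.

End mixture.

(** * Wasserstein balls *)

Section wasserstein.
Context (R : realType) (d : nat) (p : R) (p1 : 1 <= p).
Local Notation rV := 'rV[R]_d.
Local Notation brV := (borel_rV R d).
Local Notation prob := (probability brV R).
Local Notation Np mu f := (Lnorm mu p%:E (EFin \o f)).
Implicit Types P Q : prob.

Let p0 : 0 < p. Proof. exact: lt_le_trans p1. Qed.

Lemma le_Lnorm d1 (T : measurableType d1) (mu : {measure set T -> \bar R})
  (f g : T -> R) : measurable_fun setT f -> measurable_fun setT g ->
  (forall x, 0 <= f x <= g x) ->
  (Np mu (f) <= Np mu (g))%E.
Proof.
move=> mf mg fg.
have f0 x : 0 <= f x by case/andP : (fg x).
have g0 x : 0 <= g x by apply: le_trans (f0 x) _; case/andP : (fg x).
have p'0 : 0 <= p^-1 by rewrite invr_ge0 ltW.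
rewrite !LnormE//; apply: gt0_ler_poweR => //.
- rewrite in_itv/= leey andbT; apply: integral_ge0 => x _.
  by rewrite lee_fin powR_ge0.
- rewrite in_itv/= leey andbT; apply: integral_ge0 => x _.
  by rewrite lee_fin powR_ge0.
apply: ge0_le_integral => //.
- by move=> x _; rewrite lee_fin powR_ge0.
- by apply: measurableT_comp => //; apply: (measurableT_comp (measurable_powR _)).
- by apply: measurableT_comp => //; apply: (measurableT_comp (measurable_powR _)).
- move=> x _; rewrite lee_fin ge0_ler_powR// ?nnegrE// ?(ltW p0)//.
  by case/andP : (fg x).
Qed.

Lemma Pp_Lnorm Q : Pp p Q <-> (Np Q (@enorm R d) < +oo)%E.
Proof.
rewrite LnormE//; last exact: enorm_ge0.
rewrite /Pp /= unlock; split; first exact: poweR_lty.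
by apply: lty_poweRy; rewrite invr_eq0 gt_eqF.
Qed.

Lemma coupling_integral1 P Q pi (f : brV -> R) : couplings P Q pi ->
  measurable_fun setT f -> (forall x, 0 <= f x) ->
  (\int[pi]_z (f z.1)%:E = \int[P]_x (f x)%:E)%E.
Proof.
move=> [m1 _] mf f0.
rewrite -(integral_law_ge0 pi measurable_fst)//.
apply: eq_measure_integral => A mA _.
transitivity (pi (A `*` setT)); last exact: m1.
change (pi (fst @^-1` A) = pi (A `*` setT)); congr (pi _).
by apply/seteqP; split => z //= [].
Qed.

Lemma coupling_integral2 P Q pi (f : brV -> R) : couplings P Q pi ->
  measurable_fun setT f -> (forall x, 0 <= f x) ->
  (\int[pi]_z (f z.2)%:E = \int[Q]_x (f x)%:E)%E.
Proof.
move=> [_ m2] mf f0.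
rewrite -(integral_law_ge0 pi measurable_snd)//.
apply: eq_measure_integral => A mA _.
transitivity (pi (setT `*` A)); last exact: m2.
change (pi (snd @^-1` A) = pi (setT `*` A)); congr (pi _).
by apply/seteqP; split => z //= [].
Qed.

Local Notation dist := (fun z : brV * brV => enorm (z.1 - z.2 : rV)).

Let powp_ge0 (x : R) : 0 <= x `^ p. Proof. exact: powR_ge0. Qed.

Let measurable_powp d1 (T : measurableType d1) (f : T -> R) :
  measurable_fun setT f -> measurable_fun setT (fun x => f x `^ p).
Proof. by move=> mf; apply: (measurableT_comp (measurable_powR _)). Qed.

Lemma coupling_Lnorm1 P Q pi : couplings P Q pi ->
  Np pi (fun z => enorm (z.1 : rV)) = Np P (@enorm R d).
Proof.
move=> c; rewrite !LnormE//; try by move=> ?; exact: enorm_ge0.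
rewrite (coupling_integral1 (f := fun x => enorm (x : rV) `^ p) c)//.
by apply: measurable_powp; exact: measurable_enorm.
Qed.

Lemma coupling_Lnorm2 P Q pi : couplings P Q pi ->
  Np pi (fun z => enorm (z.2 : rV)) = Np Q (@enorm R d).
Proof.
move=> c; rewrite !LnormE//; try by move=> ?; exact: enorm_ge0.
rewrite (coupling_integral2 (f := fun x => enorm (x : rV) `^ p) c)//.
by apply: measurable_powp; exact: measurable_enorm.
Qed.

Lemma transport_costE (pi : probability (brV * brV)%type R) :
  (Np pi dist = transport_cost p pi `^ p^-1)%E.
Proof. by rewrite LnormE// => z; exact: enorm_ge0. Qed.

Lemma transport_cost_ge0 pi : (0 <= @transport_cost R d p pi)%E.
Proof. by apply: integral_ge0 => z _; rewrite lee_fin. Qed.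

Let measurable_enorm1 : measurable_fun [set: brV * brV] (fun z => enorm (z.1 : rV)).
Proof. by apply: (measurableT_comp (@measurable_enorm R d)). Qed.

Let measurable_enorm2 : measurable_fun [set: brV * brV] (fun z => enorm (z.2 : rV)).
Proof. by apply: (measurableT_comp (@measurable_enorm R d)). Qed.

Lemma coupling_Wball P Q pi (k : R) : couplings P Q pi -> Pp p Q ->
  (Np pi dist <= k%:E)%E -> Wball p P k Q.
Proof.
move=> c PQ; rewrite transport_costE => ck; split => //.
apply: le_trans ck; apply: gt0_ler_poweR => //.
- by rewrite invr_ge0 ltW.
- rewrite in_itv/= leey andbT; apply: le_ereal_inf_tmp => _ [pi' _ <-].
  exact: transport_cost_ge0.
- by rewrite in_itv/= leey transport_cost_ge0.
- by apply: ereal_inf_lbound; exists pi.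
Qed.

(** Minkowski's inequality applied to [|y| <= |x| + |x - y|] under an almost optimal coupling; the
    slack [e] avoids the existence of an optimal one. *)
Lemma Wball_Lnorm P Q (k : R) : 0 < k -> Wball p P k Q ->
  (Np Q (@enorm R d) <= Np P (@enorm R d) + k%:E)%E.
Proof.
move=> k0 [_ Wk]; apply/lee_addgt0Pr => e e0.
(* If every coupling cost at least [(k + e) ^ p], the Wasserstein distance would be at least
   [k + e]. *)
have [pi c ck] : exists2 pi, couplings P Q pi & (Np pi dist <= (k + e)%:E)%E.
  have [_ [pi c <-] ck] : exists2 t, [set transport_cost p pi | pi in couplings P Q] t
      & (t < ((k + e) `^ p)%:E)%E.
    apply: ereal_inf_lt; rewrite ltNge; apply/negP => h.
    have : (((k + e) `^ p)%:E `^ p^-1 <= k%:E)%E.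
      apply: le_trans Wk; apply: gt0_ler_poweR => //.
      - by rewrite invr_ge0 ltW.
      - by rewrite in_itv/= leey lee_fin powp_ge0.
      - rewrite in_itv/= leey andbT; apply: le_trans h.
        by rewrite lee_fin.
    rewrite poweR_EFin -powRrM divff ?gt_eqF// powRr1 ?lee_fin; last by lra.
    lra.
  exists pi => //; rewrite transport_costE.
  rewrite (_ : (k + e)%:E = ((k + e) `^ p)%:E `^ p^-1)%E; last first.
    by rewrite poweR_EFin -powRrM divff ?gt_eqF// powRr1//; lra.
  apply: gt0_ler_poweR; last exact: ltW.
  - by rewrite invr_ge0 ltW.
  - by rewrite in_itv/= leey transport_cost_ge0.
  - by rewrite in_itv/= leey lee_fin powp_ge0.
rewrite -addeA -EFinD -(coupling_Lnorm2 c) -(coupling_Lnorm1 c).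
apply: le_trans (leeD (lexx _) ck).
apply: le_trans (minkowski_EFin _ _ _ p1) => //; last exact: measurable_dist.
apply: le_Lnorm => //.
  by apply: measurable_funD => //; exact: measurable_dist.
move=> z; rewrite enorm_ge0/= -(enormN (z.1 - z.2)).
by apply: le_trans (enormD _ _); rewrite opprB addrC subrK.
Qed.

Lemma product_coupling P Q : couplings P Q (P \x Q)%E.
Proof.
split => A mA.
- transitivity (P A * Q setT)%E; first exact: product_measure1E.
  by rewrite probability_setT mule1.
- transitivity (P setT * Q A)%E; first exact: product_measure1E.
  by rewrite probability_setT mul1e.
Qed.

(** Under the independent coupling, Minkowski bounds the distance by the sum of the two moment
    norms. Hence a ball of large radius contains every law whose moment norm fits into what [P]
    leaves of [k]. *)
Lemma law_Wball P Q (f : brV -> brV) (mf : measurable_fun setT f) (k : R) :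
  (Np P (@enorm R d) + Np Q (fun x => enorm (f x : rV)) <= k%:E)%E ->
  Wball p P k (law Q mf).
Proof.
have NE : (Np (law Q mf) (@enorm R d) = Np Q (fun x => enorm (f x : rV)))%E.
  by rewrite Lnorm_law//; [exact: measurable_enorm|move=> y; exact: enorm_ge0].
move=> h; have lk : (Np (law Q mf) (@enorm R d) <= k%:E)%E.
  by rewrite NE; apply: le_trans h; rewrite leeDr// Lnorm_ge0.
apply: (coupling_Wball (product_coupling P (law Q mf))).
  by apply/Pp_Lnorm; apply: le_lt_trans lk _; rewrite ltry.
apply: le_trans h.
rewrite -NE -(coupling_Lnorm2 (product_coupling P (law Q mf))).
rewrite -(coupling_Lnorm1 (product_coupling P (law Q mf))).
apply: le_trans (minkowski_EFin _ _ _ p1) => //.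
apply: le_Lnorm; first exact: measurable_dist.
- exact: measurable_funD.
- by move=> z; rewrite enorm_ge0/= -(enormN z.2); exact: enormD.
Qed.

End wasserstein.

(** * Compactness in the space of strategies *)

Section topology.
Context (R : realType) (d : nat).
Local Notation rV := 'rV[R]_d.
Implicit Types (D : set rV) (w : rV).

Lemma continuous_enorm_sub w0 : continuous (fun w : rV => enorm (w - w0)).
Proof.
move=> w; apply: (@continuous_comp _ _ _ (fun v : rV => v - w0) (@enorm R d)).
  apply: (@cvgB _ _ _ _ (nbhs_filter w)); [exact: (fun A hA => hA)|exact: cvg_cst].
exact: continuous_enorm.
Qed.

Lemma closed_enorm_le w0 (r : R) : closed [set w | enorm (w - w0) <= r].
Proof.
exact: (@preimage_closed _ _ _ [set x | x <= r]
  (fun w _ => @continuous_enorm_sub w0 w) (@closed_le _ r)).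
Qed.

Lemma compact_enorm_le D (r : R) : closed D ->
  compact (D `&` [set w | enorm w <= r]).
Proof.
move=> cD; apply: bounded_closed_compact.
  exists r; split; first exact: num_real.
  by move=> x rx w [_ wr]; rewrite /= (le_trans (normr_le_enorm w))// (le_trans wr)// ltW.
apply: closedI => //; have := @closed_enorm_le 0 r.
by under eq_set do rewrite subr0.
Qed.

Lemma usc_argmax D (u : rV -> \bar R) w1 (r : R) :
  closed D -> D w1 -> (forall a, closed [set w | (a <= u w)%E]) ->
  (forall w, D w -> (u w1 <= u w)%E -> enorm w <= r) ->
  argmax D u !=set0.
Proof.
move=> cD Dw1 cu ur.
pose S := [set w | D w /\ (u w1 <= u w)%E].
pose F := filter_from S (fun w => S `&` [set v | (u w <= u v)%E]).
have FF : ProperFilter F.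
  apply: filter_from_proper; last by move=> w Sw; exists w; split => /=.
  apply: filter_from_filter; first by exists w1; split.
  move=> w w' Sw Sw'; have [h|/ltW h] := leP (u w) (u w').
  - by exists w' => // v [Sv w'v]; do 2 split => //=; exact: le_trans w'v.
  - by exists w => // v [Sv wv]; do 2 split => //=; exact: le_trans wv.
have [] := @compact_enorm_le D r cD F FF.
  by exists w1; [split|move=> v [[Dv h] _]; split => //; exact: ur].
move=> v [[Dv _]]; rewrite clusterE => clv.
have Sv w : S w -> (u w <= u v)%E.
  move=> Sw; have : F [set v | (u w <= u v)%E] by exists w => // v' [].
  by move/clv; rewrite -(closure_id _).1//; exact: cu.
exists v; split => // w Dw; have [h|/ltW h] := leP (u w1) (u w).
  exact: Sv.
by apply: le_trans h _; apply: Sv; split.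
Qed.

Lemma cvg_enorm T (F : set_system T) (FF : Filter F) (f : T -> rV) w :
  enorm (f x - w) @[x --> F] --> 0 -> f x @[x --> F] --> w.
Proof.
move=> h; apply/cvgrPdistC_le => e e0.
move/cvgrPdist_le : h => /(_ _ e0); apply: filterS => x.
by rewrite sub0r normrN ger0_norm ?enorm_ge0//; apply: le_trans; exact: normr_le_enorm.
Qed.

Lemma compact_subseq D (v : nat -> rV) : compact D ->
  (\forall n \near \oo, D (v n)) ->
  exists phi : nat -> nat, {homo phi : m n / (m < n)%N} /\
    exists2 w, D w & v (phi n) @[n --> \oo] --> w.
Proof.
move=> cD vD; have [w [Dw clw]] := cD (v n @[n --> \oo]) _ vD.
(* The subsequence is extracted from the real sequence of distances to the cluster point [w]. *)
have /cluster_eventually_cvg[phi phi_incr hphi] :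
    cluster (enorm (v n - w) @[n --> \oo]) 0.
  move=> A B vA B0.
  have [|x [Ax Bx]] := clw [set x | A (enorm (x - w))] [set x | B (enorm (x - w))] vA.
    have : enorm (x - w) @[x --> w] --> 0.
      rewrite [X in _ --> X](_ : _ = enorm (w - w)).
        exact: continuous_enorm_sub.
      by rewrite subrr enorm0.
    by apply.
  by exists (enorm (x - w)).
exists phi; split; first by move=> m n mn; have := leW_mono phi_incr m n; rewrite !ltEnat/= mn.
by exists w => //; exact: cvg_enorm hphi.
Qed.

(** A point of minimal norm maximizes [- enorm], whose superlevel sets are closed balls, the empty
    set or the whole space. *)
Lemma min_norm_neq0 D : closed D -> D !=set0 -> min_norm D !=set0.
Proof.
move=> cD [w1 Dw1].
have [||w [Dw wmax]] := @usc_argmax D (fun w => (- enorm w)%:E) w1 (enorm w1) cD Dw1.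
- case=> [a||].
  + under eq_set do rewrite lee_fin lerNr.
    have := @closed_enorm_le 0 (- a); by under eq_set do rewrite subr0.
  + by rewrite (_ : [set _ | _] = set0); [exact: closed0|apply/seteqP; split].
  + rewrite (_ : [set _ | _] = setT); first exact: closedT.
    by apply/seteqP; split => // w _ /=; rewrite leNye.
- by move=> w _; rewrite lee_fin lerN2.
exists w; split => //; apply/eqP; rewrite eq_le; apply/andP; split.
  apply: lb_le_inf; first by exists (enorm w), w.
  by move=> _ [v Dv <-]; rewrite -lerN2 -lee_fin; exact: wmax.
apply: ge_inf; last by exists w.
by exists 0 => _ [v _ <-]; exact: enorm_ge0.
Qed.

Lemma min_norm_le D w v : min_norm D w -> D v -> enorm w <= enorm v.
Proof.
move=> [_ ->] Dv; apply: ge_inf; last by exists v.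
by exists 0 => _ [v' _ <-]; exact: enorm_ge0.
Qed.

(** The bound keeps [w k] in a compact set for large [k], and every limit point has norm at most
    [enorm wbar + e] for all [e], hence minimal norm. *)
Lemma cvg_min_norm D (w : R -> rV) : closed D -> D !=set0 ->
  (forall k, 0 < k -> D (w k)) ->
  (forall wbar e, min_norm D wbar -> 0 < e ->
     exists2 K, 0 < K & forall k, K <= k -> enorm (w k) <= enorm wbar + e) ->
  (forall kn : nat -> R, kn n @[n --> \oo] --> +oo ->
     exists phi : nat -> nat, {homo phi : m n / (m < n)%N} /\
       exists2 wbar, min_norm D wbar & w (kn (phi n)) @[n --> \oo] --> wbar) /\
  (is_subset1 (min_norm D) ->
     exists2 wbar, min_norm D wbar & w k @[k --> +oo] --> wbar).
Proof.
move=> cD D0 Dw hw.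
have [wbar mwbar] := min_norm_neq0 cD D0.
have subseq (kn : nat -> R) : kn n @[n --> \oo] --> +oo ->
   exists phi : nat -> nat, {homo phi : m n / (m < n)%N} /\
     exists2 v, min_norm D v & w (kn (phi n)) @[n --> \oo] --> v.
  move=> kn_oo.
  have le_near e : 0 < e -> \forall n \near \oo,
      (D `&` [set v | enorm v <= enorm wbar + e]) (w (kn n)).
    move=> e0; have [K K0 hK] := hw _ _ mwbar e0.
    move/cvgryPge : kn_oo => /(_ K); apply: filterS => n Kn.
    by split; [exact/Dw/(lt_le_trans K0)|exact: hK].
  have [phi [phi_incr [v [Dv _] hv]]] :=
    compact_subseq (@compact_enorm_le D (enorm wbar + 1) cD) (le_near 1 ltr01).
  exists phi; split => //; exists v => //; split => //.
  rewrite -(mwbar.2); apply/eqP; rewrite eq_le (min_norm_le mwbar Dv) andbT.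
  apply/ler_addgt0Pr => e e0.
  have phi_ge n : (n <= phi n)%N.
    by elim: n => // n IH; apply: leq_ltn_trans IH _; exact: phi_incr.
  have := @closed_enorm_le 0 (enorm wbar + e).
  under eq_set do rewrite subr0.
  move=> cl; suff vn : \forall n \near \oo,
      [set v | enorm v <= enorm wbar + e] (w (kn (phi n))).
    exact: (closed_cvg _ cl vn v hv).
  have [N _ hN] := le_near e e0; exists N => // n /= Nn.
  by have [] := hN (phi n) (leq_trans Nn (phi_ge n)).
split=> // uniq; exists wbar => //.
apply: contrapT => nw.
(* Without convergence, some sequence tending to +oo keeps [w] at distance more than [e] from
   [wbar]; by uniqueness a subsequence would still converge to [wbar]. *)
have [e e0 he] : exists2 e : R, 0 < e & forall K, exists2 k, K <= k & e < `|wbar - w k|.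
  apply: contrapT => h; apply: nw; apply/cvgrPdist_le => e e0.
  apply: contrapT => h2; apply: h; exists e => // K.
  apply: contrapT => h3; apply: h2; near=> k; rewrite leNgt; apply/negP => h4.
  apply: h3; exists k => //; near: k; exact: nbhs_pinfty_ge.
pose kn (n : nat) := s2val (cid2 (he n%:R)).
have kn_ge n : n%:R <= kn n by rewrite /kn; case: cid2.
have kn_e n : e < `|wbar - w (kn n)| by rewrite /kn; case: cid2.
have kn_oo : kn n @[n --> \oo] --> +oo.
  apply/cvgryPge => A; near=> n; apply: le_trans (kn_ge n).
  by near: n; exact: nbhs_infty_ger.
have [phi [_ [v mv hv]]] := subseq _ kn_oo.
rewrite (uniq _ _ mv mwbar) in hv.
move/cvgrPdist_le : hv => /(_ _ e0)[N _ /(_ N (leqnn N))]/=.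
by rewrite leNgt kn_e.
Unshelve. all: by end_near. Qed.

End topology.

(** * Elementary inequalities for powers *)

Section power.
Context (R : realType) (p : R) (p1 : 1 <= p).

Lemma le_onep_powR (t : R) : 0 <= t -> t <= 1 + t `^ p.
Proof.
move=> t0; have [t1|/ltW t1] := leP t 1.
  by apply: le_trans t1 _; rewrite lerDl powR_ge0.
have := ler_powR t1 p1; rewrite powRr1// => /le_trans; apply.
by rewrite lerDr.
Qed.

(** This follows from [1 + t <= 2 * max(1, t)]. *)
Lemma powR_onepD (t : R) : 0 <= t -> (1 + t) `^ p <= 2 `^ p * (1 + t `^ p).
Proof.
move=> t0; have p0 : 0 <= p by rewrite (le_trans ler01).
have [t1|/ltW t1] := leP t 1.
  apply: (@le_trans _ _ (2 `^ p)).
    by apply: ge0_ler_powR => //; rewrite ?nnegrE; lra.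
  by rewrite ler_peMr ?powR_ge0// lerDl powR_ge0.
apply: (@le_trans _ _ ((2 * t) `^ p)).
  by apply: ge0_ler_powR => //; rewrite ?nnegrE; lra.
by rewrite powRM// ler_wpM2l ?powR_ge0// lerDr.
Qed.

End power.

(** * The robust utility *)

Section robust.
Context (R : realType) (d : nat) (p : R) (p1 : 1 <= p).
Context (U : R -> R).
Hypothesis U_ndecr : {homo U : x y / x <= y}.
Hypothesis U_nconst : exists x y, U x <> U y.
Hypothesis U_deriv : forall x, derivable U x 1.
Hypothesis U_conc : concave U.
Context (C1 xl : R) (C10 : 0 < C1).
Hypothesis U_growth : forall x, x <= - xl -> - C1 * (1 + `|x| `^ p) <= U x.
Context (x0 : R) (x0_neq0 : x0 != 0).
Local Notation rV := 'rV[R]_d.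
Local Notation brV := (borel_rV R d).
Local Notation prob := (probability brV R).
Local Notation Np mu f := (Lnorm mu p%:E (EFin \o f)).
Local Notation G := (derive1 U).
Implicit Types (P Q : prob) (w : rV).

(** * Growth of the utility and integrability *)

Let tangent := concave_tangent U_deriv U_conc.
Let G_ge0 := concave_deriv_ge0 U_ndecr U_deriv U_conc.

(** From above, [U] is bounded by its tangent at 0; from below, by the growth hypothesis left of
    [- xl] and by monotonicity right of it. *)
Lemma utility_growth : exists2 C, 0 <= C &
  forall y, `|U y| <= C * (1 + `|y| `^ p).
Proof.
pose C := C1 + `|U (- xl)| + 2 * (`|U 0| + G 0).
have G0 := G_ge0 0.
have a0 := normr_ge0 (U 0); have axl := normr_ge0 (U (- xl)).
exists C; first by rewrite /C; move: C10; lra.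
move=> y; have yp := powR_ge0 `|y| p.
have y1 := le_onep_powR p1 (normr_ge0 y).
have h1 : U y <= (`|U 0| + G 0) * (2 * (1 + `|y| `^ p)).
  have := tangent 0 y; rewrite subr0.
  have := ler_norm (U 0); have := ler_norm y; have := normr_ge0 y.
  nra.
have h2 : - ((C1 + `|U (- xl)|) * (1 + `|y| `^ p)) <= U y.
  have [hy|/ltW hy] := leP y (- xl).
    by have := U_growth hy; nra.
  have := U_ndecr hy; have := ler_norm (- U (- xl)); rewrite normrN.
  by move: C10; nra.
by rewrite ler_norml /C; apply/andP; split; move: C10; nra.
Qed.

(** This makes the utility of any wealth of linear growth integrable under every measure with finite
    p-th moment. *)
Lemma utility_affine_growth c : 0 <= c -> exists2 B, 0 <= B &
  forall t s, 0 <= t -> `|s| <= c * (1 + t) -> `|U s| <= B * (1 + t `^ p).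
Proof.
move=> c0; have [C C0 UC] := utility_growth.
have c2 : 0 <= c `^ p * 2 `^ p by rewrite mulr_ge0 ?powR_ge0.
exists (C * (1 + c `^ p * 2 `^ p)); first by rewrite mulr_ge0// addr_ge0.
move=> t s t0 st; apply: le_trans (UC s) _; rewrite -mulrA ler_wpM2l//.
have h : `|s| `^ p <= c `^ p * 2 `^ p * (1 + t `^ p).
  apply: (@le_trans _ _ ((c * (1 + t)) `^ p)).
    have ct0 : 0 <= c * (1 + t) by rewrite mulr_ge0// addr_ge0.
    by apply: ge0_ler_powR => //; exact: le_trans p1.
  rewrite powRM// ?addr_ge0// -mulrA ler_wpM2l ?powR_ge0//.
  exact: powR_onepD.
by have := powR_ge0 t p; nra.
Qed.

Lemma measurable_utility : measurable_fun setT U.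
Proof.
apply: continuous_measurable_fun => x; apply: differentiable_continuous.
exact/derivable1_diffP.
Qed.

Lemma integrable_powp Q : Pp p Q ->
  Q.-integrable setT (fun x => (enorm (x : rV) `^ p)%:E).
Proof.
rewrite /Pp /= unlock => Qp; apply/integrableP; split.
  apply: measurableT_comp => //; apply: (measurableT_comp (measurable_powR _)).
  exact: measurable_enorm.
by under eq_integral do rewrite /= ger0_norm ?powR_ge0//.
Qed.

Lemma integrable_growth Q (f : brV -> R) (B : R) : Pp p Q ->
  measurable_fun setT f -> 0 <= B ->
  (forall x, `|f x| <= B * (1 + enorm (x : rV) `^ p)) ->
  Q.-integrable setT (EFin \o f).
Proof.
move=> Qp mf B0 fB.
apply: (@le_integrable _ _ _ Q setT measurableT _
  (fun x => B%:E * ((cst 1%R x)%:E + (enorm (x : rV) `^ p)%:E))%E) => //.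
- exact: measurableT_comp.
- move=> x _ /=; rewrite lee_fin (le_trans (fB x))// ler_norm//.
apply: integrableZl => //; apply: integrableD => //.
- exact: finite_measure_integrable_cst.
- exact: integrable_powp.
Qed.

Lemma integrable_utility Q (h : brV -> R) (c : R) : Pp p Q ->
  measurable_fun setT h -> 0 <= c ->
  (forall x, `|h x| <= c * (1 + enorm (x : rV))) ->
  Q.-integrable setT (fun x => (U (h x))%:E).
Proof.
move=> Qp mh c0 hc; have [B B0 UB] := utility_affine_growth c0.
apply: (@integrable_growth _ (U \o h) B) => //.
  by apply: measurableT_comp => //; exact: measurable_utility.
by move=> x; apply: UB => //; exact: enorm_ge0.
Qed.

Lemma integrable_enorm Q : Pp p Q ->
  Q.-integrable setT (EFin \o (fun x => enorm (x : rV))).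
Proof.
move=> Qp; apply: (@integrable_growth _ _ 1) => //.
  exact: measurable_enorm.
by move=> x; rewrite mul1r ger0_norm ?enorm_ge0// le_onep_powR// enorm_ge0.
Qed.

Definition wealth w (x : rV) := x0 + x0 * dot w x.

Lemma measurable_wealth w : measurable_fun [set: brV] (wealth w : brV -> R).
Proof.
apply: measurable_funD => //; apply: measurable_funM => //.
exact: measurable_dot.
Qed.

Lemma wealth_le w x : `|wealth w x| <= `|x0| * (1 + enorm w) * (1 + enorm x).
Proof.
apply: le_trans (ler_normD _ _) _; rewrite normrM -mulrA -{1}(mulr1 `|x0|) -mulrDr.
rewrite ler_wpM2l//; have := dot_le w x.
by have := enorm_ge0 w; have := enorm_ge0 x; nra.
Qed.

Lemma integrable_wealth Q w : Pp p Q ->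
  Q.-integrable setT (fun x => (U (wealth w x))%:E).
Proof.
move=> Qp; apply: integrable_utility (wealth_le w) => //.
  exact: measurable_wealth.
by rewrite mulr_ge0// addr_ge0// enorm_ge0.
Qed.

(** * Expected utility and its upper semicontinuity in the strategy *)

Definition EU Q w := (\int[Q]_x (U (wealth w x))%:E)%E.

Lemma EU_fin Q w : Pp p Q -> EU Q w \is a fin_num.
Proof. by move=> Qp; exact/integrable_fin_num/integrable_wealth. Qed.

Local Notation u P := (robust_utility p P x0 U).

Lemma robust_utilityE P k w :
  u P k w = ereal_inf [set EU Q w | Q in Wball p P k].
Proof. by rewrite /robust_utility unlock. Qed.

Lemma robust_utility_le P k w Q : Wball p P k Q -> (u P k w <= EU Q w)%E.
Proof. by move=> QB; rewrite robust_utilityE; apply: ereal_inf_lbound; exists Q. Qed.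

Lemma integral_lin Q (f g : brV -> R) a b :
  Q.-integrable setT (EFin \o f) -> Q.-integrable setT (EFin \o g) ->
  (\int[Q]_x (a * f x + b * g x)%:E =
   a%:E * \int[Q]_x (f x)%:E + b%:E * \int[Q]_x (g x)%:E)%E.
Proof.
move=> fi gi; under eq_integral do rewrite EFinD !EFinM.
by rewrite integralD// ?integralZl//; exact: integrableZl.
Qed.

Lemma integrable_lin Q (f g : brV -> R) a b :
  Q.-integrable setT (EFin \o f) -> Q.-integrable setT (EFin \o g) ->
  Q.-integrable setT (fun x => (a * f x + b * g x)%:E).
Proof.
move=> fi gi.
have -> : (fun x => (a * f x + b * g x)%:E) =
    ((fun x => a%:E * (f x)%:E) \+ (fun x => b%:E * (g x)%:E))%E by [].
by apply: integrableD => //; exact: integrableZl.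
Qed.

Lemma integrable_cstR Q (c : R) : Q.-integrable setT (EFin \o (fun=> c)).
Proof. exact: finite_measure_integrable_cst. Qed.

Lemma integral_cstR Q (c : R) : (\int[Q]_x (c%:E) = c%:E)%E.
Proof.
transitivity (c%:E * Q setT)%E; first exact: integral_cst.
by rewrite probability_setT mule1.
Qed.

(** Changing [w] by less than [h / |x0|] raises the wealth by at most [h * enorm x]. By
    [concave_extrapolation] the utility is then at most [(1 + h) * f - h * g] with [f] and [g]
    integrable, and this bound tends to [f] in mean as [h] tends to 0. *)
Lemma closed_EU Q (a : \bar R) : Pp p Q -> closed [set w | (a <= EU Q w)%E].
Proof.
move=> Qp w clw; rewrite /=.
pose f (x : brV) := U (wealth w x).
pose g (x : brV) := U (wealth w x - enorm (x : rV)).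
have fi : Q.-integrable setT (EFin \o f) by exact: integrable_wealth.
have gi : Q.-integrable setT (EFin \o g).
  apply: (@integrable_utility _ _ (`|x0| * (1 + enorm w) + 1)) => //.
  - apply: measurable_funB; first exact: measurable_wealth.
    exact: measurable_enorm.
  - by rewrite addr_ge0// mulr_ge0// addr_ge0// enorm_ge0.
  move=> x; apply: le_trans (ler_normB _ _) _; rewrite mulrDl mul1r.
  by rewrite lerD ?wealth_le// ger0_norm ?enorm_ge0// lerDr.
have [r fr] : exists r, (\int[Q]_x (f x)%:E = r%:E)%E.
  by have /fineK <- := integrable_fin_num measurableT fi; eexists.
have [s gs] : exists s, (\int[Q]_x (g x)%:E = s%:E)%E.
  by have /fineK <- := integrable_fin_num measurableT gi; eexists.
apply/lee_addgt0Pr => e e0.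
(* The bound integrates to [r + h * (r - s)], and this [h] keeps the excess over [r] below [e]; the
   added 1 avoids a zero denominator. *)
pose h := e / (`|r - s| + 1).
have h0 : 0 < h by rewrite divr_gt0// ltr_pwDr.
have [w' [aw' ww']] : ([set w | (a <= EU Q w)%E] `&`
    [set w' | enorm (w' - w) < h / `|x0|]) !=set0.
  apply: clw; have : enorm (w' - w) @[w' --> w] --> enorm (w - w).
    exact: continuous_enorm_sub.
  rewrite subrr enorm0 => /cvgr_lt; apply.
  by rewrite divr_gt0// normr_gt0.
apply: le_trans aw' _.
have : (EU Q w' <= \int[Q]_x ((1 + h) * f x + (- h) * g x)%:E)%E.
  apply: le_integral => //; first exact: integrable_wealth.
    exact: integrable_lin.
  move=> x _; rewrite lee_fin.
  apply: (@le_trans _ _ (U (wealth w x + h * enorm (x : rV)))).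
    apply: U_ndecr; rewrite /wealth -[w'](subrK w) dotDl.
    have : x0 * dot (w' - w) x <= h * enorm (x : rV).
      apply: le_trans (ler_norm _) _; rewrite normrM.
      move: ww'; rewrite /= ltr_pdivlMr ?normr_gt0// => ww'.
      have := dot_le (w' - w) x; have := normr_ge0 x0; have := enorm_ge0 (x : rV).
      nra.
    rewrite mulrDr; lra.
  have := concave_extrapolation U_deriv U_conc (wealth w x) (enorm_ge0 (x : rV)) (ltW h0).
  rewrite -/(f x) -/(g x); lra.
rewrite integral_lin// fr gs => /le_trans; apply.
rewrite /EU -/f fr -!EFinM -!EFinD lee_fin.
have : h * (`|r - s| + 1) = e by rewrite /h divfK// gt_eqF// ltr_pwDr.
have := ler_norm (r - s); nra.
Qed.

(** A superlevel set of an infimum is the intersection of the superlevel sets over the ball. *)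
Lemma closed_robust_utility P k (a : \bar R) :
  closed [set w | (a <= u P k w)%E].
Proof.
move=> w clw; rewrite /= robust_utilityE; apply: le_ereal_inf_tmp => _ [Q QB <-].
apply: (closed_EU (a := a) QB.1); apply: closureS clw => v /= av.
by apply: le_trans av _; exact: robust_utility_le.
Qed.

(** * Moments over the ball, worst points and point masses *)

Lemma powRVK (s : R) : 0 <= s -> (s `^ p) `^ p^-1 = s.
Proof. by move=> s0; rewrite -powRrM divff ?powRr1// gt_eqF// (lt_le_trans _ p1). Qed.

Lemma Lnorm_cstR Q (s : R) : 0 <= s -> Np Q (fun=> s) = s%:E.
Proof.
by move=> s0; rewrite LnormE// integral_cstR poweR_EFin powRVK.
Qed.

Lemma Lnorm_enorm_fin Q : Pp p Q -> exists2 n, 0 <= n & Np Q (@enorm R d) = n%:E.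
Proof.
move=> /(Pp_Lnorm p1); have := Lnorm_ge0 Q p%:E (EFin \o @enorm R d).
by case: (Lnorm _ _ _) => // n; rewrite lee_fin => n0 _; exists n.
Qed.

Lemma Wball_powp_le P Q n k : Np P (@enorm R d) = n%:E -> 0 <= n -> 0 < k ->
  Wball p P k Q -> (\int[Q]_x (enorm (x : rV) `^ p)%:E <= ((n + k) `^ p)%:E)%E.
Proof.
move=> Pn n0 k0 QB; have := Wball_Lnorm p1 k0 QB; rewrite Pn => h.
have -> : (\int[Q]_x (enorm (x : rV) `^ p)%:E = Np Q (@enorm R d) `^ p)%E.
  rewrite poweR_Lnorm; last by rewrite gt_eqF// (lt_le_trans _ p1).
  by apply: eq_integral => x _; rewrite /= ger0_norm ?enorm_ge0.
rewrite -poweR_EFin; apply: gt0_ler_poweR => //.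
- exact: le_trans p1.
- by rewrite in_itv/= leey Lnorm_ge0.
- by rewrite in_itv/= leey lee_fin addr_ge0// ltW.
Qed.

(** The utility is at least [- B * (1 + |x| ^ p)], and p-th moments are bounded uniformly over the
    ball. *)
Lemma robust_utility_ge P k w : Pp p P -> 0 < k ->
  exists c : R, (c%:E <= u P k w)%E.
Proof.
move=> PP k0; have [n n0 Pn] := Lnorm_enorm_fin PP.
have c0 : 0 <= `|x0| * (1 + enorm w) by rewrite mulr_ge0// addr_ge0// enorm_ge0.
have [B B0 UB] := utility_affine_growth c0.
exists (- B * 1 + - B * (n + k) `^ p).
rewrite robust_utilityE; apply: le_ereal_inf_tmp => _ [Q QB <-].
have Qp := QB.1.
apply: (@le_trans _ _ (\int[Q]_x (- B * 1 + - B * (enorm (x : rV) `^ p))%:E)%E).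
  rewrite (integral_lin _ _ (integrable_cstR Q 1) (integrable_powp Qp)).
  have [i ie] : exists i, (\int[Q]_x (enorm (x : rV) `^ p)%:E = i%:E)%E.
    have /fineK <- := integrable_fin_num measurableT (integrable_powp Qp).
    by eexists.
  have := Wball_powp_le Pn n0 k0 QB; rewrite integral_cstR ie -!EFinM -EFinD !lee_fin.
  nra.
apply: le_integral => //; last 2 first.
- exact: integrable_wealth.
- move=> x _; rewrite lee_fin.
  have := UB (enorm (x : rV)) _ (enorm_ge0 _) (wealth_le w x).
  by rewrite ler_norml => /andP[+ _]; apply: le_trans; lra.
exact: (integrable_lin _ _ (integrable_cstR Q 1) (integrable_powp Qp)).
Qed.

(* The point at distance [s] from the origin at which the wealth of strategy
   [w] is smallest. *)
Definition worst_point w (s : R) : rV := (- Num.sg x0 * s / enorm w) *: w.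

Lemma wealth_worst_point w s : 0 < enorm w ->
  wealth w (worst_point w s) = x0 - s * `|x0| * enorm w.
Proof.
move=> w0; rewrite /wealth dotZr -sqr_enorm normrEsg.
by field; rewrite gt_eqF.
Qed.

Lemma enorm_worst_point w s : 0 < enorm w -> 0 <= s ->
  enorm (worst_point w s) = s.
Proof.
move=> w0 s0; rewrite enormZ !normrM normrN normr_sg x0_neq0 mul1r.
by rewrite normfV !ger0_norm ?enorm_ge0// divfK// gt_eqF.
Qed.

(** The Dirac measure at [z], written as the image of [P] under a constant map so that the results
    on [law] apply. *)
Definition point_mass P (z : rV) : prob :=
  law P (measurable_cst (z : brV) : measurable_fun setT (fun=> z : brV)).

Lemma integral_point_mass P z (g : brV -> R) : measurable_fun setT g ->
  (\int[point_mass P z]_x (g x)%:E = (g z)%:E)%E.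
Proof.
move=> mg; rewrite integral_law// ?integral_cstR//.
exact: integrable_cstR.
Qed.

Lemma measurable_utility_wealth w :
  measurable_fun [set: brV] (fun x : brV => U (wealth w x)).
Proof.
apply: measurableT_comp; first exact: measurable_utility.
exact: measurable_wealth.
Qed.

Lemma EU_point_mass P z w : EU (point_mass P z) w = (U (wealth w z))%:E.
Proof.
exact: (integral_point_mass _ _ (measurable_utility_wealth w)).
Qed.

Lemma point_mass_Wball P n k z : Np P (@enorm R d) = n%:E ->
  n + enorm z <= k -> Wball p P k (point_mass P z).
Proof.
move=> Pn nk; apply: law_Wball => //.
by rewrite Pn Lnorm_cstR ?enorm_ge0// -EFinD lee_fin.
Qed.

Lemma robust_utility_worst_point P n k w s : Np P (@enorm R d) = n%:E ->
  0 < enorm w -> 0 <= s -> n + s <= k ->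
  (u P k w <= (U (x0 - s * `|x0| * enorm w))%:E)%E.
Proof.
move=> Pn w0 s0 nk; rewrite -wealth_worst_point// -(EU_point_mass P).
apply: robust_utility_le; apply: (point_mass_Wball Pn).
by rewrite enorm_worst_point.
Qed.

(* Under [Q], replacing X by a multiple of the worst direction for [w] of length
   (1 + e) |<v, X>| / |w| gives [w] the wealth x0 - (1 + e) |x0 <v, X>|, which
   [concave_star] compares with the wealth of [v]. *)
Lemma robust_utility_scaling P n k v w e : Np P (@enorm R d) = n%:E ->
  0 <= n -> 0 < k -> 0 < enorm w -> 0 <= e ->
  n + (1 + e) * enorm v / enorm w * (n + k) <= k ->
  forall Q, Wball p P k Q -> (u P k w <= (1 + e)%:E * EU Q v - (e * U x0)%:E)%E.
Proof.
move=> Pn n0 k0 w0 e0 hk Q QB; have Qp := QB.1.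
pose f (x : rV) : rV := worst_point w ((1 + e) * `|dot v x| / enorm w).
have f_ge0 (x : rV) : 0 <= (1 + e) * `|dot v x| / enorm w.
  by rewrite divr_ge0 ?enorm_ge0// mulr_ge0// addr_ge0.
have mf : measurable_fun [set: brV] (f : brV -> brV).
  apply: continuous_borel_measurable_rV => x.
  have xF := nbhs_filter x.
  apply: cvgZ; last exact: cvg_cst.
  apply: cvgM; last exact: cvg_cst; apply: cvgM; first exact: cvg_cst.
  apply: cvgM; last exact: cvg_cst; apply: cvgM; first exact: cvg_cst.
  by apply: cvg_norm; exact: continuous_dot.
have c0 : 0 <= (1 + e) * enorm v / enorm w.
  by rewrite divr_ge0 ?enorm_ge0// mulr_ge0 ?enorm_ge0// addr_ge0.
have f_le x : enorm (f x) <= (1 + e) * enorm v / enorm w * enorm x.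
  rewrite enorm_worst_point//= ler_pdivrMr//.
  have -> : (1 + e) * enorm v / enorm w * enorm (x : rV) * enorm w =
    (1 + e) * (enorm v * enorm (x : rV)) by field; rewrite gt_eqF.
  by apply: ler_wpM2l; rewrite ?addr_ge0// dot_le.
have fB : Wball p P k (law Q mf).
  apply: law_Wball => //; rewrite Pn.
  pose c := (1 + e) * enorm v / enorm w.
  (* The map [f] shrinks norms by the factor [c] at least, and [Q] has moment norm at most [n + k];
     the hypothesis on [k] is the budget that [law_Wball] then asks for. *)
  have QW : (Np Q (fun x => (c * enorm (x : rV))%R) <= (c * (n + k))%:E)%E.
    rewrite LnormE; last by move=> x; rewrite mulr_ge0// enorm_ge0.
    have -> : (\int[Q]_x ((c * enorm (x : rV)) `^ p)%:E =
        (c `^ p)%:E * \int[Q]_x (enorm (x : rV) `^ p)%:E)%E.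
      rewrite -integralZl//; last exact: integrable_powp.
      by apply: eq_integral => x _; rewrite powRM// enorm_ge0.
    have ck0 : 0 <= c * (n + k) by rewrite mulr_ge0// addr_ge0// ltW.
    rewrite -(powRVK ck0) -(poweR_EFin ((c * (n + k)) `^ p)); apply: gt0_ler_poweR.
    - by rewrite invr_ge0 (le_trans _ p1).
    - rewrite in_itv/= leey andbT mule_ge0// ?lee_fin ?powR_ge0//.
      by apply: integral_ge0 => x _; rewrite lee_fin powR_ge0.
    - by rewrite in_itv/= leey lee_fin powR_ge0.
    rewrite [X in (_ <= X%:E)%E]powRM ?addr_ge0 ?(ltW k0)// EFinM lee_wpmul2l ?lee_fin ?powR_ge0//.
    exact: Wball_powp_le QB.
  apply: (@le_trans _ _ (n%:E + (c * (n + k))%:E)%E); last by rewrite -EFinD lee_fin.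
  apply: leeD2l; apply: le_trans QW; apply: le_Lnorm => //.
  - by apply: (measurableT_comp (@measurable_enorm R d)).
  - by apply: measurable_funM => //; exact: measurable_enorm.
  by move=> x; rewrite enorm_ge0 f_le.
apply: le_trans (robust_utility_le _ fB) _.
have ify : Q.-integrable setT (fun x : brV => (U (wealth w (f x)))%:E).
  pose c := (1 + e) * enorm v / enorm w; have w1 : 0 <= 1 + enorm w by rewrite addr_ge0// ltW.
  apply: (@integrable_utility _ (wealth w \o f) (`|x0| * (1 + enorm w) * (1 + c))) => //.
  - exact: (measurableT_comp (measurable_wealth w) mf).
  - by rewrite !mulr_ge0// addr_ge0.
  move=> x; apply: le_trans (wealth_le _ _) _; rewrite -[leRHS]mulrA ler_wpM2l ?mulr_ge0//.
  have := f_le x; rewrite -/c => fx; have := enorm_ge0 (x : rV).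
  have : 0 <= c by []. nra.
rewrite /EU integral_law//; last exact: measurable_utility_wealth.
have iUv := integrable_wealth v Qp.
have -> : ((1 + e)%:E * EU Q v - (e * U x0)%:E =
    \int[Q]_x ((1 + e) * U (wealth v x) + - e * U x0)%:E)%E.
  rewrite (integral_lin _ _ iUv (integrable_cstR Q (U x0))).
  by rewrite integral_cstR -EFinM mulNr EFinN.
apply: le_integral => //.
  exact: (integrable_lin _ _ iUv (integrable_cstR Q (U x0))).
move=> x _; rewrite lee_fin wealth_worst_point//.
have -> : (1 + e) * `|dot v x| / enorm w * `|x0| * enorm w =
    (1 + e) * (`|x0| * `|dot v x|) by field; rewrite gt_eqF.
(* With t = [|x0 * dot v x|], the value [x0 - t] is at most the wealth of [v], so monotonicity
   concludes. *)
apply: le_trans (concave_star U_deriv U_conc _ _ e0) _.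
rewrite mulNr lerD2r ler_wpM2l ?addr_ge0//; apply: U_ndecr.
rewrite /wealth lerD2l -normrM; have := ler_norm (- (x0 * dot v x)).
by rewrite normrN; lra.
Qed.

(** * Comparison of strategies at large radii *)

Lemma worst_wealth_decay c : 0 < c -> exists2 s, 0 <= s &
  forall c', c <= c' -> U (x0 - s * `|x0| * c') < U x0.
Proof.
move=> c0; have [t0 t00 ht] := concave_ray_decay U_ndecr U_nconst U_deriv U_conc (U x0).
have x00 : 0 < `|x0| by rewrite normr_gt0.
(* This [s] solves [s * |x0| * c = |x0| + t0], which brings the wealth down to at most [- t0]. *)
exists ((`|x0| + t0) / (`|x0| * c)).
  by rewrite divr_ge0 ?mulr_ge0// ?addr_ge0// ltW.
move=> c' cc'.
rewrite (_ : x0 - _ = - ((`|x0| + t0) / c * c' - x0)); last first.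
  by field; rewrite !gt_eqF.
apply: ht; have : `|x0| + t0 <= (`|x0| + t0) / c * c'.
  by rewrite -mulrA ler_peMr ?addr_ge0// mulrC ler_pdivlMr// mul1r.
by have := ler_norm x0; lra.
Qed.

Lemma wealth0 x : wealth 0 x = x0.
Proof. by rewrite /wealth dotC dot0r mulr0 addr0. Qed.

Lemma robust_utility_far P v e : Pp p P -> 0 < e -> exists2 K, 0 < K &
  forall k w, K <= k -> enorm v + e <= enorm w -> (u P k w < u P k v)%E.
Proof.
move=> PP e0; have [n n0 Pn] := Lnorm_enorm_fin PP.
have := enorm_ge0 v; rewrite le_eqVlt => /predU1P[/esym/enorm_eq0 ->|v0].
  have [s s0 hs] := worst_wealth_decay e0.
  exists (n + s + 1) => [|k w Kk]; first by rewrite ltr_wpDl// addr_ge0.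
  rewrite enorm0 add0r => ew.
  apply: le_lt_trans (robust_utility_worst_point Pn (lt_le_trans e0 ew) s0 _) _.
    by apply: le_trans Kk; lra.
  apply: (@lt_le_trans _ _ (U x0)%:E); first by rewrite lte_fin hs.
  rewrite robust_utilityE; apply: le_ereal_inf_tmp => _ [Q _ <-].
  rewrite /EU; under eq_integral do rewrite wealth0.
  by rewrite integral_cstR.
have [s s0 hs] := worst_wealth_decay v0.
(* With [eta = e / (2 * m)] below, [(1 + eta) * m = m + e / 2]; since [enorm w >= m + e], the
   scaling factor is at most [r < 1]. *)
pose m := enorm v; pose r := (m + e / 2) / (m + e).
have me : 0 < m + e by rewrite addr_gt0.
have r1 : 0 < 1 - r.
  by rewrite subr_gt0 ltr_pdivrMr// mul1r; lra.
have r0 : 0 <= r by rewrite divr_ge0// ltW// addr_gt0// divr_gt0.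
(* The first bound lets the ball contain the point mass at distance [s]; the second is the condition
   [n + r * (n + k) <= k] solved for [k]. *)
exists (Num.max (n + s + 1) (n * (1 + r) / (1 - r))).
  by rewrite lt_max ltr_wpDl// addr_ge0.
move=> k w; rewrite ge_max => /andP[Kk1 Kk2] ew.
have k0 : 0 < k by apply: lt_le_trans Kk1; rewrite ltr_wpDl// addr_ge0.
have w0 : 0 < enorm w by apply: lt_le_trans ew.
pose eta := e / (2 * m).
have eta0 : 0 < eta by rewrite divr_gt0// mulr_gt0.
have budget : n + (1 + eta) * enorm v / enorm w * (n + k) <= k.
  have : (1 + eta) * enorm v / enorm w <= r.
    rewrite ler_pdivrMr// /r mulrAC ler_pdivlMr//.
    have -> : (1 + eta) * enorm v = m + e / 2.
      by rewrite /eta /m; field; rewrite gt_eqF.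
    by rewrite ler_wpM2l// addr_ge0 ?divr_ge0// ltW.
  move: Kk2; rewrite ler_pdivrMr// => Kk2 rr.
  have : (1 + eta) * enorm v / enorm w * (n + k) <= r * (n + k).
    by rewrite ler_wpM2r// addr_ge0// ltW.
  lra.
have scal := robust_utility_scaling Pn n0 k0 w0 (ltW eta0) budget.
have worst : (u P k v <= (U (x0 - s * `|x0| * m))%:E)%E.
  by apply: (robust_utility_worst_point Pn v0 s0); lra.
have Us : U (x0 - s * `|x0| * m) < U x0 by exact: hs.
rewrite ltNge; apply/negP => vw.
have [c hc] := robust_utility_ge v PP k0.
have [y uy] : exists y, u P k v = y%:E.
  by move: worst hc; case: (u P k v) => // y _ _; exists y.
suff : U x0 <= y by rewrite leNgt => /negP; apply; apply: le_lt_trans Us; rewrite -lee_fin -uy.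
(* If [w] did at least as well as [v], then [y <= (1 + eta) * EU Q v - eta * U x0] for all [Q] in
   the ball. Taking the infimum over [Q] yields [U x0 <= y], against the worst-point bound. *)
have : (((y + eta * U x0) / (1 + eta))%:E <= y%:E)%E.
  rewrite -[X in (_ <= X)%E]uy robust_utilityE; apply: le_ereal_inf_tmp => _ [Q QB <-].
  have := le_trans vw (scal Q QB); rewrite uy.
  rewrite -(fineK (EU_fin v QB.1)) -EFinM -EFinB !lee_fin => h.
  by rewrite ler_pdivrMr ?addr_gt0//; lra.
rewrite lee_fin ler_pdivrMr ?addr_gt0// mulrDr mulr1 lerD2l mulrC.
by rewrite ler_pM2r.
Qed.

(** * Mixtures close to [P] and coercivity *)

Lemma mixture_Wball P z I k e (e0 : 0 <= e) (e1 : 0 <= 1 - e) :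
  Pp p P -> enorm z <= 1 -> 0 < k ->
  (\int[P]_x (enorm (x : rV) `^ p)%:E = I%:E)%E ->
  e * (2 `^ p * (1 + I)) <= k `^ p ->
  Wball p P k (mixture (point_mass P z) P e0 e1).
Proof.
move=> PP z1 k0 PI ek.
have mz : measurable_fun setT (fun x : brV => (x, z : brV)).
  exact: measurable_fun_pair.
have mx : measurable_fun setT (fun x : brV => (x, x)).
  exact: measurable_fun_pair.
(* This coupling moves a share [e] of the mass to [z] and leaves the rest in place, so only that
   share is charged, at most [2 ^ p * (1 + I)] per unit. *)
pose pi : probability (brV * brV)%type R := mixture (law P mz) (law P mx) e0 e1.
have c : couplings P (mixture (point_mass P z) P e0 e1) pi.
  split => A mA.
  - have lz : law P mz (A `*` setT) = P A.
      by congr (P _); apply/seteqP; split => x //= [].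
    have lx : law P mx (A `*` setT) = P A.
      by congr (P _); apply/seteqP; split => x //= [].
    transitivity (e%:E * law P mz (A `*` setT) + (1 - e)%:E * law P mx (A `*` setT))%E.
      exact: mixtureE.
    by rewrite lz lx -ge0_muleDl ?lee_fin// -EFinD addrC subrK mul1e.
  - have lz : law P mz (setT `*` A) = point_mass P z A.
      by congr (P _); apply/seteqP; split => x //= [].
    have lx : law P mx (setT `*` A) = P A.
      by congr (P _); apply/seteqP; split => x //= [].
    transitivity (e%:E * law P mz (setT `*` A) + (1 - e)%:E * law P mx (setT `*` A))%E.
      exact: mixtureE.
    by rewrite lz lx; symmetry; exact: mixtureE.
have mpow : measurable_fun [set: brV] (fun x => enorm (x : rV) `^ p).
  by apply: (measurableT_comp (measurable_powR _)); exact: measurable_enorm.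
have mdist : measurable_fun [set: brV * brV] (fun y => enorm (y.1 - y.2 : rV) `^ p).
  by apply: (measurableT_comp (measurable_powR _)); exact: measurable_dist.
apply: (coupling_Wball p1 c).
  rewrite /Pp /= unlock ge0_integral_mixture//; last 2 first.
  - exact: measurableT_comp.
  - by move=> x; rewrite lee_fin powR_ge0.
  by rewrite (integral_point_mass _ _ mpow) PI -!EFinM -EFinD ltry.
rewrite LnormE; last by move=> y; exact: enorm_ge0.
rewrite ge0_integral_mixture//; last 2 first.
- exact: measurableT_comp.
- by move=> x; rewrite lee_fin powR_ge0.
rewrite !(integral_law_ge0 _ _ mdist)//; try by move=> y; rewrite powR_ge0.
rewrite [X in (_ + _ * X)%E](_ : _ = 0%E); last first.
  apply: integral0_eq => x _ /=.
  by rewrite subrr enorm0 powR0// gt_eqF// (lt_le_trans _ p1).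
rewrite mule0 adde0 -(powRVK (ltW k0)) -(poweR_EFin (k `^ p)).
have cost : (\int[P]_x (enorm (x - z : rV) `^ p)%:E <= (2 `^ p * (1 + I))%:E)%E.
  rewrite mulrDr mulr1 -[X in (X + _)%R]mulr1.
  rewrite EFinD EFinM (EFinM _ I) -PI -(integral_cstR P 1).
  rewrite -(integral_lin _ _ (integrable_cstR P 1) (integrable_powp PP)).
  apply: ge0_le_integral => //.
  - by move=> x _; rewrite lee_fin powR_ge0.
  - apply: measurableT_comp => //; apply: (measurableT_comp mdist mz).
  - exact: (measurable_int _ (integrable_lin _ _ (integrable_cstR P 1) (integrable_powp PP))).
  move=> x _; rewrite lee_fin -mulrDr.
  apply: le_trans (powR_onepD p1 (enorm_ge0 (x : rV))).
  apply: ge0_ler_powR; rewrite ?nnegrE ?addr_ge0 ?enorm_ge0 ?(le_trans _ p1)//.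
  by apply: le_trans (enormD _ _) _; rewrite enormN addrC lerD2r.
apply: gt0_ler_poweR.
- by rewrite invr_ge0 (le_trans _ p1).
- rewrite in_itv/= leey andbT mule_ge0// ?lee_fin//.
  by apply: integral_ge0 => x _; rewrite lee_fin powR_ge0.
- by rewrite in_itv/= leey lee_fin powR_ge0.
by apply: le_trans (lee_wpmul2l _ cost) _; rewrite ?lee_fin// -EFinM lee_fin.
Qed.

(** Mass [e] at the worst unit vector loses at least at rate [e * G a * |x0|] in [enorm w], up to
    constants, while the remaining mass gains at most at rate [(1 - e) * G b * m * |x0|]. The slopes
    are chosen so that the gain is at most half the loss. *)
Lemma robust_utility_coercive P k w1 : Pp p P -> 0 < k ->
  (forall e, 0 < e -> exists a b, 0 < G a /\ G b <= e * G a) ->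
  exists r, forall w, (u P k w1 <= u P k w)%E -> enorm w <= r.
Proof.
move=> PP k0 ratio; have [c hc] := robust_utility_ge w1 PP k0.
have [I PI] : exists I, (\int[P]_x (enorm (x : rV) `^ p)%:E = I%:E)%E.
  have /fineK <- := integrable_fin_num measurableT (integrable_powp PP).
  by eexists.
have [m Pm] : exists m, (\int[P]_x (enorm (x : rV))%:E = m%:E)%E.
  have /fineK <- := integrable_fin_num measurableT (integrable_enorm PP).
  by eexists.
have m0 : 0 <= m.
  by rewrite -lee_fin -Pm; apply: integral_ge0 => x _; rewrite lee_fin enorm_ge0.
have I0 : 0 <= I.
  by rewrite -lee_fin -PI; apply: integral_ge0 => x _; rewrite lee_fin powR_ge0.
pose K := 2 `^ p * (1 + I).
have K0 : 0 < K by rewrite mulr_gt0 ?powR_gt0// ltr_wpDr.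
(* The first bound keeps the weight [1 - e] positive, the second keeps the mixture in the ball. *)
pose e := Num.min 2^-1 (k `^ p / K).
have e0 : 0 < e by rewrite lt_min invr_gt0 ltr0n divr_gt0// powR_gt0.
have e1 : 0 <= 1 - e by have : e <= 2^-1 by [rewrite ge_min lexx]; lra.
have eK : e * K <= k `^ p by rewrite -ler_pdivlMr// ge_min lexx orbT.
(* This ratio gives [G b * (m + 1) <= e / 2 * G a]. *)
have [|a [b [Ga Gb]]] := ratio (e / (2 * (m + 1))).
  by rewrite divr_gt0// mulr_gt0// ltr_wpDl.
(* The constant terms of the tangents at [a] and [b], weighted by the mixture; the radius below
   solves [c <= C - e / 2 * G a * |x0| * enorm w] for [enorm w]. *)
pose C := e * (U a + G a * (x0 - a)) + (1 - e) * (U b + G b * (`|x0| - b)).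
have x00 : 0 < `|x0| by rewrite normr_gt0.
exists (Num.max 0 ((C - c) / (`|x0| * (e / 2 * G a)))) => w uw.
have := enorm_ge0 w; rewrite le_eqVlt => /predU1P[<-|w0]; first by rewrite le_max lexx.
rewrite le_max; apply/orP; right.
pose z := worst_point w 1.
have z1 : enorm z <= 1 by rewrite enorm_worst_point.
have QB := mixture_Wball (ltW e0) e1 PP z1 k0 PI eK.
have := le_trans hc (le_trans uw (robust_utility_le w QB)).
have [N _ PN] := Lnorm_enorm_fin PP.
have zp : Pp p (point_mass P z) := (point_mass_Wball PN (lexx _)).1.
rewrite /EU (integral_mixture _ _ (integrable_wealth w zp) (integrable_wealth w PP)).
rewrite -/(EU (point_mass P z) w) EU_point_mass wealth_worst_point// mul1r.
pose alpha := U b + G b * (`|x0| - b); pose beta := G b * `|x0| * enorm w.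
have : (EU P w <= (alpha * 1 + beta * m)%:E)%E.
  rewrite EFinD EFinM (EFinM beta) -Pm -(integral_cstR P 1).
  rewrite -(integral_lin _ _ (integrable_cstR P 1) (integrable_enorm PP)).
  apply: le_integral => //; first exact: integrable_wealth.
    exact: (integrable_lin _ _ (integrable_cstR P 1) (integrable_enorm PP)).
  move=> x _; rewrite lee_fin; apply: le_trans (tangent b _) _.
  have : wealth w x <= `|x0| + `|x0| * (enorm w * enorm (x : rV)).
    rewrite /wealth; apply: lerD; first exact: ler_norm.
    by apply: le_trans (ler_norm _) _; rewrite normrM ler_wpM2l// dot_le.
  move=> /(ler_wpM2l (G_ge0 b)); rewrite /alpha /beta; lra.
rewrite -/(EU P w) -(fineK (EU_fin w PP)) -!EFinM -EFinD !lee_fin.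
move=> /(ler_wpM2l e1) h1 h2.
have h3 := ler_wpM2l (ltW e0) (tangent a (x0 - `|x0| * enorm w)).
rewrite ler_pdivlMr ?mulr_gt0// ?divr_gt0//.
have h4 : (1 - e) * (G b * m) <= e / 2 * G a.
  have : G b * (m + 1) <= e / 2 * G a.
    rewrite -ler_pdivlMr ?ltr_wpDl//; apply: le_trans Gb _.
    by rewrite le_eqVlt; apply/orP; left; apply/eqP; field; rewrite gt_eqF// ltr_wpDl.
  by have := G_ge0 b; have : 0 <= G b * m by [rewrite mulr_ge0]; nra.
have h5 := ler_wpM2r (ltW (mulr_gt0 x00 w0)) h4.
by move: h1 h2 h3 h5; rewrite /alpha /beta /C; lra.
Qed.

End robust.

(** Here [w] is an arbitrary selection of maximizers. The comparison of utilities controls only the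
    norm of [w k], so the limit is taken along subsequences in general, and along all [k] when the
    point of minimal norm is unique. *)
Theorem theorem1p1 (R : realType) (d : nat) (p : R)
    (P : probability (borel_rV R d) R) (x0 : R) (D : set 'rV[R]_d)
    (U : R -> R) (C1 xl : R)
    (p_ge1 : 1 <= p) (P_Pp : Pp p P) (x0_neq0 : x0 != 0)
    (D_neq0 : D !=set0) (D_closed : closed D)
    (U_nondecreasing : {homo U : x y / x <= y})
    (U_nonconstant : exists x y, U x <> U y)
    (U_differentiable : forall x, derivable U x 1)
    (U_concave : concave U)
    (C1_gt0 : 0 < C1) (xl_gt0 : 0 < xl) (U_xl : U (- xl) < 0)
    (U_growth : forall x, x <= - xl -> - C1 * (1 + `|x| `^ p) <= U x)
    (U_cond : has_ubound (range U)
              \/ (1 < AE_ninfty U)%E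
              \/ (AE_pinfty U < 1)%E) :
  let u := robust_utility p P x0 U in
  (forall k, 0 < k -> argmax D (u k) !=set0) /\
  (forall w : R -> 'rV[R]_d,
     (forall k, 0 < k -> argmax D (u k) (w k)) ->
     (forall kn : nat -> R, kn n @[n --> \oo] --> +oo ->
        exists phi : nat -> nat, {homo phi : m n / (m < n)%N} /\
          exists2 wbar, min_norm D wbar &
            w (kn (phi n)) @[n --> \oo] --> wbar) /\
     (is_subset1 (min_norm D) ->
        exists2 wbar, min_norm D wbar & w k @[k --> +oo] --> wbar)).
Proof.
have [wbar mwbar] := min_norm_neq0 D_closed D_neq0.
split=> [k k0|w hw].
  have [w1 Dw1] := D_neq0.
  have [r hr] := robust_utility_coercive p_ge1 U_nondecreasing U_differentiable
    U_concave C1_gt0 U_growth x0_neq0 w1 P_Pp k0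
    (slope_ratio U_nondecreasing U_nonconstant U_differentiable U_concave
       U_xl U_cond).
  apply: (@usc_argmax _ _ _ _ w1 r) => // [a|w _]; last exact: hr.
  exact: (closed_robust_utility p_ge1 U_nondecreasing U_differentiable
    U_concave C1_gt0 U_growth x0_neq0).
apply: cvg_min_norm => // [k k0|v e mv e0]; first by have [] := hw k k0.
have [K K0 hK] := robust_utility_far p_ge1 U_nondecreasing U_nonconstant
  U_differentiable U_concave C1_gt0 U_growth x0_neq0 v P_Pp e0.
(* If [enorm (w k)] exceeded [enorm v + e], then [v] would do strictly better than the maximizer
   [w k]. *)
exists K => // k Kk; rewrite leNgt; apply/negP => /ltW /(hK _ _ Kk).
by rewrite ltNge (hw k (lt_le_trans K0 Kk)).2//; exact: mv.1.
Qed.
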